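(* For every $n\ge 3$, the map $g=[g_1,\dots,g_{n-1}]$ is holomorphic on $\mathbf{CP}^{n-2}$; that is, the polynomials $g_1,\dots,g_{n-1}$ have no common zero in $\mathbf{C}^{n-1}\setminus\{0\}$.
   Context: Use homogeneous coordinates $u=(u_1,\dots,u_{n-1})$ on $\mathbf{CP}^{n-2}$. Let $S_{n,\ell}$ be the elementary symmetric polynomial of degree $\ell$ in $u_1,\dots,u_{n-1}$, with $S_{n,0}=1$. Define $g=[g_1,\dots,g_{n-1}]$ by $$g_\ell=u_\ell^3\,G_\ell,\qquad G_\ell=\sum_{k=0}^{n-2}(-1)^k\,\frac{k+1}{k+3}\,u_\ell^k\,S_{n,n-2-k},\qquad \ell=1,\dots,n-1.$$ *)

(* Defs.v *)
From HB Require Import structures.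
From mathcomp Require Import all_boot all_order all_algebra.
From mathcomp Require Import reals.
From mathcomp Require Import complex.
From mathcomp Require Import mpoly.

Set Implicit Arguments.
Unset Strict Implicit.
Unset Printing Implicit Defensive.

Import GRing.Theory Num.Theory.
Local Open Scope ring_scope.
Local Open Scope complex_scope.

(* The coordinate u_(l+1) of the homogeneous coordinates u_1, ..., u_(n-1) on
   CP^(n-2) is the indeterminate 'X_l, with l : 'I_n.-1; for R : realType, the
   field of complex numbers is R[i]. *)

Definition Snl (R : realType) (n l : nat) : {mpoly R[i][n.-1]} :=
  mesym n.-1 R[i] l.

Lemma Snl0 (R : realType) (n : nat) : Snl R n 0 = 1.
Proof. exact: mesym0E. Qed.

(* The subtraction n - 2 - k is exact for n >= 2, as k < n.-1. *)
Definition G (R : realType) (n : nat) (l : 'I_n.-1) : {mpoly R[i][n.-1]} :=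
  \sum_(k < n.-1)
    ((-1) ^+ k * (k.+1%:R / k.+3%:R)) *: ('X_l ^+ k * Snl R n (n - 2 - k)).

Definition g (R : realType) (n : nat) (l : 'I_n.-1) : {mpoly R[i][n.-1]} :=
  'X_l ^+ 3 * G R l.

(* Main.v *)
Require Import Defs.
From HB Require Import structures.
From mathcomp Require Import all_boot all_order all_algebra.
From mathcomp Require Import reals.
From mathcomp Require Import complex.
From mathcomp Require Import mpoly.
From mathcomp Require Import zify ring.

Set Implicit Arguments.
Unset Strict Implicit.
Unset Printing Implicit Defensive.

Import GRing.Theory Num.Theory.
Local Open Scope ring_scope.
Local Open Scope complex_scope.

(** Let [P = prod_i (X - u_i)], of degree [N = n - 1], and let [F] be the
    antiderivative of [X^2 P'] vanishing at [0]. Up to sign, [g_l(u)] is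
    [F(u_l)]. If all of these vanish, then at a root [a] of [P] the order of [F]
    is one more than that of [X^2 P'], hence equals that of [X^2 P], so
    [X^2 P] divides [F]. Both have degree [N + 2], so they are proportional, and
    comparing coefficients gives [P = X^N], that is [u = 0]. *)

Lemma mup_deriv (K : numFieldType) (p : {poly K}) (a : K) :
  p != 0 -> root p a -> mup a p = (mup a p^`()).+1.
Proof.
move=> p0 pa; have [m [q]] := multiplicity_XsubC p a.
rewrite p0 /= => qa Dp; case: m Dp => [|m] Dp.
  by move: pa qa; rewrite Dp expr0 mulr1 => ->.
rewrite {1}Dp mupMr // mup_XsubCX eqxx Dp derivM deriv_exp derivXsubC mul1r /=.
have -> : q^`() * ('X - a%:P) ^+ m.+1 + q * (('X - a%:P) ^+ m *+ m.+1)
   = (q^`() * ('X - a%:P) + q *+ m.+1) * ('X - a%:P) ^+ m.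
  by rewrite exprS mulrA mulrDl mulrnAr mulrnAl.
rewrite mupMr ?mup_XsubCX ?eqxx // /root !hornerE subrr mulr0 add0r.
by rewrite hornerMn mulrn_eq0.
Qed.

Lemma dvdp_prod_XsubC_mup (K : fieldType) (s : seq K) (q : {poly K}) :
  q != 0 -> (forall a, (count_mem a s <= mup a q)%N) ->
  \prod_(a <- s) ('X - a%:P) %| q.
Proof.
elim: s q => [|b s IHs] q q0 cq; first by rewrite big_nil dvd1p.
have: 'X - b%:P %| q.
  by rewrite XsubC_dvd // (leq_trans _ (cq b)) //= eqxx.
case/dvdpP=> r Dq; rewrite big_cons Dq mulrC.
have r0 : r != 0 by apply: contraNneq q0 => r0; rewrite Dq r0 mul0r.
rewrite dvdp_mul2r ?polyXsubC_eq0 //; apply: IHs => // a.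
have := cq a; rewrite /= Dq mupM ?polyXsubC_eq0 //.
by rewrite (@mup_XsubCX _ 1) addnC leq_add2r.
Qed.

(* The antiderivative of ['X^2 * p^`()], divided by ['X^2] so that the root 0
   needs no separate treatment. *)
Definition antideriv2 (K : numFieldType) (p : {poly K}) : {poly K} :=
  \poly_(j < size p) (j%:R / j.+2%:R * p`_j).

Lemma coef_antideriv2 (K : numFieldType) (p : {poly K}) j :
  (antideriv2 p)`_j = j%:R / j.+2%:R * p`_j.
Proof.
rewrite coef_poly; case: ltnP => // le_pj.
by rewrite [p`_j]nth_default // mulr0.
Qed.

Lemma deriv_antideriv2 (K : numFieldType) (p : {poly K}) :
  ('X^2 * antideriv2 p)^`() = 'X^2 * p^`().
Proof.
apply/polyP => i; rewrite coef_deriv !coefXnM.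
case: i => [|[|i]] /=.
- by rewrite mul0rn.
- by rewrite coef_antideriv2 !mul0r mul0rn.
rewrite !subSS !subn0 coef_antideriv2 coef_deriv -[LHS]mulr_natl -[RHS]mulr_natl.
by rewrite mulrA [_ * (_ / _)]mulrC divfK ?pnatr_eq0.
Qed.

Lemma split_antideriv2_roots (K : numFieldType) (s : seq K)
    (p := \prod_(a <- s) ('X - a%:P)) :
  (forall a, a \in s -> root ('X^2 * antideriv2 p) a) -> p = 'X^(size s).
Proof.
move=> Fs; have [s_nil | s0] := eqVneq s [::].
  by rewrite /p s_nil big_nil.
have sz0 : (0 < size s)%N by rewrite lt0n size_eq0.
have szp : size p = (size s).+1 by rewrite /p size_prod_XsubC.
have p_mon : p \is monic by apply: monic_prod_XsubC.
have lcp : p`_(size s) = 1 by rewrite -(monicP p_mon) lead_coefE szp.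
set N := size s in sz0 szp lcp *.
have HN : (antideriv2 p)`_N != 0.
  rewrite coef_antideriv2 lcp mulr1 mulf_neq0 ?invr_eq0 ?pnatr_eq0 //.
  by rewrite -lt0n.
have H0 : antideriv2 p != 0.
  by apply: contraNneq HN => ->; rewrite coef0.
have X20 : 'X^2 != 0 :> {poly K} by rewrite expf_neq0 ?polyX_eq0.
have F0 : 'X^2 * antideriv2 p != 0 by rewrite mulf_neq0.
have p0 : p != 0 by apply: monic_neq0.
have dp0 : p^`() != 0.
  apply/eqP => /(congr1 (fun q : {poly K} => q`_N.-1)).
  by rewrite coef_deriv prednK // lcp coef0 => /eqP; rewrite pnatr_eq0 eqn0Ngt sz0.
have /dvdpP[c DH] : p %| antideriv2 p.
  apply: dvdp_prod_XsubC_mup => // a; rewrite -mu_prod_XsubC -/p.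
  have [sa | sNa] := boolP (a \in s); last first.
    by rewrite mupNroot // root_prod_XsubC.
  have pa : root p a by rewrite root_prod_XsubC.
  have := mup_deriv F0 (Fs a sa).
  rewrite deriv_antideriv2 (mupM a X20 H0) (mupM a X20 dp0).
  by rewrite -addnS -mup_deriv // => /addnI ->.
have c0 : c != 0 by apply: contraNneq H0 => c0; rewrite DH c0 mul0r.
have szc : size c = 1%N.
  have : (size (c * p)%R <= size p)%N by rewrite -DH size_poly.
  rewrite size_mul // szp addnS /= -[X in (_ <= X)%N]add1n leq_add2r.
  by move=> c1; apply/eqP; rewrite eqn_leq c1 size_poly_gt0.
have Dc : c = (c`_0)%:P by apply: size1_polyC; rewrite szc.
have coefH j : j%:R / j.+2%:R * p`_j = c`_0 * p`_j.
  by rewrite -coef_antideriv2 DH {1}Dc coefCM.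
have cN : c`_0 = N%:R / N.+2%:R by have := coefH N; rewrite lcp !mulr1.
apply/polyP => j; rewrite coefXn; have [-> // | jN] := eqVneq j N.
apply/eqP; have /eqP := coefH j.
rewrite -subr_eq0 -mulrBl mulf_eq0 cN subr_eq0 eqr_div ?pnatr_eq0 //.
rewrite -!natrM eqr_nat.
by case/orP=> // /eqP jN2; case/eqP: jN; lia.
Qed.

Lemma dhomog_g (R : realType) (n : nat) (l : 'I_n.-1) :
  @g R n l \is (3 + (n - 2)).-homog.
Proof.
have hX : ('X_l : {mpoly R[i][n.-1]}) \is 1.-homog by rewrite dhomogX /= mdeg1.
apply: dhomogM; first exact: (dhomogMn 3 hX).
apply: rpred_sum => k _; apply: rpredZ.
have nk : (n - 2 = k + (n - 2 - k))%N.
  by have := ltn_ord k; lia.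
have := dhomogM (dhomogMn k hX) (dhomog_mesym n.-1 R[i] (n - 2 - k)).
by rewrite mul1n -nk.
Qed.

Lemma meval_g (R : realType) (n : nat) (l : 'I_n.-1) (u : 'I_n.-1 -> R[i])
    (p := \prod_(a <- [tuple u i | i < n.-1]) ('X - a%:P)) :
  ('X^2 * antideriv2 p).[u l] = (-1) ^+ (n - 2) * (@g R n l).@[u].
Proof.
rewrite hornerM hornerXn horner_poly size_prod_XsubC size_tuple.
rewrite big_ord_recl !mul0r add0r.
rewrite /g mevalM rmorphXn /= mevalXU raddf_sum /= !mulr_sumr; apply: eq_bigr => k _.
rewrite mevalZ mevalM rmorphXn /= mevalXU.
have ltk := ltn_ord k.
have lt_nk : (n - 2 - k < n.-1.+1)%N by lia.
have := mroots_coeff [tuple u i | i < n.-1] (Ordinal lt_nk).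
rewrite -/p /= /bump /= add1n (_ : n.-1 - (n - 2 - k) = k.+1)%N; last by lia.
have sgn : (-1) ^+ (n - 2 - k) = (-1) ^+ (n - 2) * (-1) ^+ k :> R[i].
  rewrite -[in RHS](@subnK k (n - 2)); last by lia.
  by rewrite exprD -mulrA -expr2 sqrr_sign mulr1.
move=> ->; rewrite sgn (meval_eq (v2 := u)); last by move=> i; rewrite tnth_mktuple.
rewrite -/(Snl R n (n - 2 - k)) !exprS.
move: (_ / _) (_.@[u]) (_ ^+ (n - 2)) (_ ^+ k) (u l ^+ k) => c e s t v.
by ring.
Qed.

(* The first conjunct is what makes u |-> [g_1(u), ..., g_(n-1)(u)] compatible
   with the scaling of homogeneous coordinates; the second one is that it is
   then defined (hence holomorphic) at every point of CP^(n-2). *)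
Theorem theorem4p3 (R : realType) (n : nat) (hn : (3 <= n)%N) :
  (exists d : nat, forall l : 'I_n.-1, @g R n l \is d.-homog) /\
  ~ (exists u : 'rV[R[i]]_n.-1,
        u != 0 /\ forall l : 'I_n.-1, (@g R n l).@[fun i => u ord0 i] = 0).
Proof.
split; first by exists (3 + (n - 2))%N => l; apply: dhomog_g.
case=> u [/eqP u0 gu]; apply: u0; apply/rowP => l; rewrite mxE.
set s := [tuple u ord0 i | i < n.-1].
have ps : \prod_(a <- s) ('X - a%:P) = 'X^(size s).
  apply: split_antideriv2_roots => _ /tnthP[i ->].
  by rewrite tnth_mktuple /root meval_g gu mulr0.
have : u ord0 l \in s.
  by apply/tnthP; exists l; rewrite tnth_mktuple.
rewrite -root_prod_XsubC ps /root hornerXn expf_eq0.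
by case/andP=> _ /eqP.
Qed.
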